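(* Algorithm monobeam with an admissible heuristic and beam width $k+1$ will always return a solution with cost lower than or equal to the cost of the solution it would have returned if it had been run (on the same problem) with beam width $k$, for all $k \ge 1$.
   Context: Search problem. There is a set of states, a start state, a set of goal states, and for each state a set of actions (operators), each leading to a successor state and having a nonnegative cost. The domain does not contain infinite sequences of zero-cost operators. A node is a sequence of actions from the start state; it represents the state at its end. The node ''start'' is the empty sequence. The children of a node are its one-action extensions. $g(n)$ is the total cost of the actions of $n$. A solution is a node representing a goal state; its cost is its $g$-value. The heuristic $h \ge 0$ (cost-to-go estimate of the state represented by a node) is admissible: it never exceeds the cost of any path from that state to a goal state (so $h=0$ on goals). It need not be consistent. $f$-values. $f(n)=g(n)+h(n)$, corrected by pathmax: when a child of a node $n$ is generated and $f(\text{child})<f(n)$, then $f(\text{child})$ is set to $f(n)$. Selection rule. ''The minimum $f$-value node'' of candidates is a node of smallest $f$-value, with ties broken on low $h$-values. Algorithm monobeam(start, width). A beam is an array with slots $1,\dots,\text{width}$, each either empty or containing one node. Initially solutionCost $=\infty$, beam[1] = start, all other slots are empty. While at least one slot of beam contains a node with $f$-value $<$ solutionCost, do one iteration: (1) Set candidates $=\emptyset$ and let nextBeam have all slots empty. (2) For $c=1,2,\dots,\text{width}$ in this order: (2a) if beam[c] contains a node, then for each child of it (with pathmax applied): if the child is a goal, then, if moreover $f(\text{child})<$ solutionCost, store it as the incumbent solution and set solutionCost $= f(\text{child})$; if the child is not a goal, add it to candidates. (2b) If candidates is nonempty, remove its minimum $f$-value node and put it in nextBeam[c]. (3) Set beam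 = nextBeam. When the loop ends, return the stored incumbent solution. No duplicate detection is performed.
   Formalization: That the width k+1 run terminates is proved only if positive action costs are bounded away from 0 (else it can fail); any solution it returns costs no more without this. Action sets are finite, and both runs break remaining ties by the same rule. *)

(* Defs.v *)
From HB Require Import structures.
From mathcomp Require Import all_boot all_order all_algebra.
From mathcomp Require Import reals constructive_ereal.

Set Implicit Arguments.
Unset Strict Implicit.
Unset Printing Implicit Defensive.
Import Order.TTheory GRing.Theory Num.Theory.
Local Open Scope ring_scope.

(* States may be infinite in number. The finite action set of a state is given
   as a duplicate-free sequence, which is also the order in which the children
   of a node are generated. *)
Record search_problem (R : realType) := SearchProblem {
  state : Type;
  action : eqType;
  start : state;
  goal : pred state;
  actions : state -> seq action;
  next : state -> action -> state;
  cost : state -> action -> R;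
  actions_uniq : forall s, uniq (actions s);
  cost_ge0 : forall s a, a \in actions s -> 0 <= cost s a
}.

Section Problem.
Variables (R : realType) (P : search_problem R).

Definition no_infinite_zero_cost_sequence : Prop :=
  ~ exists (s : nat -> state P) (a : nat -> action P),
      forall i, [/\ a i \in actions (s i),
                    s i.+1 = next (s i) (a i)
                  & cost (s i) (a i) = 0].

(* Automatic when there are finitely many states, or when costs are integers. *)
Definition positive_costs_bounded_below : Prop :=
  exists2 d : R, 0 < d &
    forall (s : state P) (a : action P),
      a \in actions s -> cost s a != 0 -> d <= cost s a.

(* Action sequences are stored with the most recent action first, so that the
   one-action extension of p by a is a :: p. *)
Fixpoint target (s : state P) (p : seq (action P)) : state P :=
  if p is a :: p' then next (target s p') a else s.

Fixpoint legal (s : state P) (p : seq (action P)) : bool :=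
  if p is a :: p' then legal s p' && (a \in actions (target s p')) else true.

Fixpoint path_cost (s : state P) (p : seq (action P)) : R :=
  if p is a :: p' then path_cost s p' + cost (target s p') a else 0.

Definition node : eqType := seq (action P).

Definition node_state (n : node) : state P := target (start P) n.

Definition g (n : node) : R := path_cost (start P) n.

Definition children (n : node) : seq node :=
  [seq a :: n | a <- actions (node_state n)].

Definition is_solution (n : node) : Prop :=
  legal (start P) n /\ goal (node_state n).

Variable h : state P -> R.

Definition admissible : Prop :=
  forall (s : state P) (p : seq (action P)),
    legal s p -> goal (target s p) -> h s <= path_cost s p.

Definition hn (n : node) : R := h (node_state n).

(* g + h corrected by pathmax: the parent of a :: n is n. *)
Fixpoint f (n : node) : R :=
  if n is a :: n' then Num.max (f n') (g n + hn n) else g n + hn n.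

(* A rule picking one node out of the candidates, listed in the order in which
   they were generated. Ties that remain after comparing f and then h are
   resolved arbitrarily, but as a function of the candidates. *)
Definition selects_minimum (select : seq node -> node) : Prop :=
  forall C : seq node, C != [::] ->
    select C \in C /\
    forall n, n \in C ->
      f (select C) < f n \/ (f (select C) = f n /\ hn (select C) <= hn n).

Variable select : seq node -> node.

Record memory := Memory {
  candidates : seq node;
  incumbent : option node;
  solution_cost : \bar R
}.

Definition generate (m : memory) (c : node) : memory :=
  if goal (node_state c) then
    if ((f c)%:E < solution_cost m)%E then
      Memory (candidates m) (Some c) (f c)%:E
    else m
  else Memory (rcons (candidates m) c) (incumbent m) (solution_cost m).

Definition expand (m : memory) (slot : option node) : memory :=
  if slot is Some n then foldl generate m (children n) else m.

Definition pick_slot (m : memory) : option node * memory :=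
  if candidates m is [::] then (None, m)
  else let n := select (candidates m) in
       (Some n, Memory (rem n (candidates m)) (incumbent m) (solution_cost m)).

Fixpoint fill_slots (m : memory) (beam : seq (option node)) :
    seq (option node) * memory :=
  if beam is slot :: beam' then
    let: (slot', m') := pick_slot (expand m slot) in
    let: (next_beam, m'') := fill_slots m' beam' in
    (slot' :: next_beam, m'')
  else ([::], m).

Record config := Config {
  beam : seq (option node);
  best : option node;
  best_cost : \bar R
}.

(* Slot c of the beam is entry c - 1 of the sequence. *)
Definition initial (width : nat) : config :=
  Config (mkseq (fun c => if c == 0%N then Some [::] else None) width)
         None +oo%E.

Definition continues (c : config) : bool :=
  has (fun slot => if slot is Some n then ((f n)%:E < best_cost c)%E else false)
      (beam c).

Definition iteration (c : config) : config :=
  let: (next_beam, m) :=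
    fill_slots (Memory [::] (best c) (best_cost c)) (beam c) in
  Config next_beam (incumbent m) (solution_cost m).

Inductive loop : config -> config -> Prop :=
| loop_exit c : ~~ continues c -> loop c c
| loop_next c c' : continues c -> loop (iteration c) c' -> loop c c'.

(* The loop terminates and the stored incumbent is r; r = None means that no
   solution has been found. *)
Definition monobeam_returns (width : nat) (r : option node) : Prop :=
  exists2 c, loop (initial width) c & best c = r.

End Problem.

(* Main.v *)
(** Slot c of the next beam is determined by slots 1, ..., c of the current beam
    alone, and never by the incumbent. Hence at every iteration the beam of width
    k is the beam of width k+1 without its last slot, and the wider run has
    generated every goal generated by the narrower one. If the wider run stops
    before the solution s of the narrower run is generated, an ancestor n of s is
    in both beams, so the incumbent of the wider run costs at most f(n), and
    f(n) <= f(s) by pathmax. Finally f = g on solutions, by admissibility.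

    If the wider run did not stop, its beams would contain arbitrarily deep nodes
    whose cost is below that of s. König's lemma then yields an infinite action
    sequence of bounded cost; when positive costs are bounded below it ends in
    zero-cost actions only. *)

Require Import Defs.
From mathcomp Require Import all_boot all_order all_algebra.
From mathcomp Require Import boolp reals constructive_ereal.

Set Implicit Arguments.
Unset Strict Implicit.
Unset Printing Implicit Defensive.
Import Order.TTheory GRing.Theory Num.Theory.
Local Open Scope ring_scope.

(** * König's lemma for a finitely branching relation *)

(** Some child of a deep vertex is deep: otherwise the finitely many children have depth bounds, and
    their sum bounds the depth below the vertex. *)
Lemma konig (T : eqType) (kids : T -> seq T) (r := fun x y => y \in kids x)
    (x : T) :
  (forall N, exists2 s, size s = N & path r x s) ->
  exists2 u : nat -> T, u 0%N = x & forall i, r (u i) (u i.+1).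
Proof.
pose deep y := forall N, exists2 s, size s = N & path r y s.
have deepS y : deep y -> exists2 z, r y z & deep z.
  move=> dy; apply: contrapT => nz.
  have shallow z : z \in kids y ->
      exists N, forall s, path r z s -> (size s < N)%N.
    move=> zy; apply: contrapT => nN; apply: nz; exists z => // N.
    apply: contrapT => ns; apply: nN; exists N => s ps.
    rewrite ltnNge; apply/negP => Ns; apply: ns; exists (take N s).
      by rewrite size_takel.
    exact: take_path.
  have [N NP] : exists N, forall z s,
      z \in kids y -> path r z s -> (size s < N)%N.
    elim: (kids y) shallow => [|z l IH] sh; first by exists 0%N.
    have [N1 N1P] := sh z (mem_head _ _).
    have [|N2 N2P] := IH.
      by move=> w wl; apply: sh; rewrite inE wl orbT.
    exists (N1 + N2)%N => w s; rewrite inE => /orP[/eqP->|wl] ps.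
      by rewrite ltn_addr ?N1P.
    by rewrite ltn_addl ?(N2P w).
  have [[|z s] //= [sN] /andP[yz ps]] := dy N.+1.
  by have := NP z s yz ps; rewrite sN ltnn.
move=> dx.
(* [choice] needs a total relation, so a vertex that is not deep is paired with itself as a dummy
   value. *)
have /choice[F FP] : forall y, exists z, deep y -> r y z /\ deep z.
  move=> y.
  have [/deepS[z yz dz]|ndy] := pselect (deep y); first by exists z.
  by exists y.
exists (fun i => iter i F x) => // i.
have dxi : deep (iter i F x) by elim: i => //= i /FP[].
by have [] := FP _ dxi.
Qed.

(** * Path costs and pathmax *)

Section Monobeam.
Variables (R : realType) (P : search_problem R) (h : state P -> R).
Implicit Types (n c : node P) (a : action P).

Lemma f_ge_gh n : g n + hn h n <= f h n.
Proof. by case: n => [|a n] //=; rewrite le_max lexx orbT. Qed.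

Lemma f_parent a n : f h n <= f h (a :: n).
Proof. by rewrite /= le_max lexx. Qed.

Lemma target_cat (s : state P) (p q : seq (action P)) :
  target s (p ++ q) = target (target s q) p.
Proof. by elim: p => //= a p ->. Qed.

Lemma legal_cat (s : state P) (p q : seq (action P)) :
  legal s (p ++ q) = legal s q && legal (target s q) p.
Proof. by elim: p => [|a p IH] /=; rewrite ?andbT // IH target_cat andbA. Qed.

Lemma path_cost_cat (s : state P) (p q : seq (action P)) :
  path_cost s (p ++ q) = path_cost s q + path_cost (target s q) p.
Proof.
by elim: p => [|a p IH] /=; rewrite ?addr0 // IH target_cat addrA.
Qed.

(** By pathmax, [f h n] is the maximum of [g + hn] over the ancestors of [n]. The actions leading
    from an ancestor to [n] form a path to a goal, so admissibility bounds each of these values by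
    [g n]. *)
Lemma f_solution n :
  (forall s, 0 <= h s) -> admissible h -> is_solution n -> f h n = g n.
Proof.
move=> h_ge0 h_adm [ln gn]; apply/eqP; rewrite eq_le; apply/andP; split; last first.
  by apply: le_trans (f_ge_gh n); rewrite lerDl h_ge0.
have gh_le p q : n = p ++ q -> g q + hn h q <= g n.
  move=> En; move: ln gn; rewrite /node_state /g En legal_cat target_cat.
  move=> /andP[_ lp] gp; rewrite path_cost_cat lerD2l; exact: h_adm.
have f_le q : forall p, n = p ++ q -> f h q <= g n.
  elim: q => [|a q IH] p En; first exact: gh_le En.
  rewrite [f _ _]/= ge_max (gh_le _ _ En) andbT.
  (* Passing from [a :: q] to its parent [q] makes [a] the earliest action of the remaining path,
     hence the last entry of [p]. *)
  by apply: (IH (rcons p a)); rewrite cat_rcons.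
exact: (f_le n [::]).
Qed.

(** * Comparison of two memories with the same candidates *)

Section Run.
Variable select : seq (node P) -> node P.
Hypothesis Hselect : selects_minimum h select.

Lemma fill_slots_cat (m : memory P) b1 b2 :
  let: (n1, m1) := fill_slots h select m b1 in
  let: (n2, m2) := fill_slots h select m1 b2 in
  fill_slots h select m (b1 ++ b2) = (n1 ++ n2, m2).
Proof.
elim: b1 m => [|x b1 IH] m /=; first by case: fill_slots.
case: pick_slot => s m'; have := IH m'.
by case: fill_slots => n1 m1; case: fill_slots => n2 m2 ->.
Qed.

(** The incumbents themselves may differ between two runs; equal candidates are what makes [select]
    pick the same nodes. *)
Definition no_worse (m2 m1 : memory P) : Prop :=
  candidates m2 = candidates m1 /\ (solution_cost m2 <= solution_cost m1)%E.

Lemma generate_cost (m : memory P) c :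
  solution_cost (generate h m c) =
  if goal (node_state c) then Order.min (f h c)%:E (solution_cost m)
  else solution_cost m.
Proof. by rewrite /generate /Order.min; case: ifP => //; case: ifP. Qed.

Lemma generate_candidates (m : memory P) c :
  candidates (generate h m c) =
  if goal (node_state c) then candidates m else rcons (candidates m) c.
Proof. by rewrite /generate; case: ifP => //; case: ifP. Qed.

(** The goal test alone decides whether a child becomes a candidate, and the cost is updated by a
    minimum, which is monotone. *)
Lemma generate_no_worse (m2 m1 : memory P) c :
  no_worse m2 m1 -> no_worse (generate h m2 c) (generate h m1 c).
Proof.
move=> [ec le21]; split; rewrite ?generate_candidates ?generate_cost ?ec //.
by case: ifP => // _; rewrite le_min !ge_min lexx le21 orbT.
Qed.

Lemma expand_no_worse (m2 m1 : memory P) x :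
  no_worse m2 m1 -> no_worse (Defs.expand h m2 x) (Defs.expand h m1 x).
Proof.
case: x => //= n; elim: (children n) m2 m1 => //= c l IH m2 m1 le21.
exact/IH/generate_no_worse.
Qed.

Lemma pick_slot_no_worse (m2 m1 : memory P) : no_worse m2 m1 ->
  (pick_slot select m2).1 = (pick_slot select m1).1 /\
  no_worse (pick_slot select m2).2 (pick_slot select m1).2.
Proof.
by case: m2 m1 => [C2 i2 s2] [C1 i1 s1] [/= -> le21]; rewrite /pick_slot; case: C1.
Qed.

Lemma fill_slots_no_worse (m2 m1 : memory P) b : no_worse m2 m1 ->
  (fill_slots h select m2 b).1 = (fill_slots h select m1 b).1 /\
  no_worse (fill_slots h select m2 b).2 (fill_slots h select m1 b).2.
Proof.
elim: b m2 m1 => //= x b IH m2 m1 /(expand_no_worse x)/pick_slot_no_worse.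
case: pick_slot => s2 m2'; case: pick_slot => s1 m1' [/= -> /IH].
by case: fill_slots => b2 m2''; case: fill_slots => b1 m1'' [/= ->].
Qed.

(** * Origin of the beam nodes and of the incumbent *)

(* [i0] and [s0] are the incumbent and its cost before the iteration; [Q] will
   be the set of children of the current beam. *)
Record generated_from (Q : node P -> Prop) (i0 : option (node P)) (s0 : \bar R)
    (m : memory P) : Prop := GeneratedFrom {
  candidates_from : forall c, c \in candidates m -> Q c;
  cost_from : (solution_cost m <= s0)%E;
  incumbent_from : (incumbent m = i0 /\ solution_cost m = s0) \/
    exists c, [/\ Q c, goal (node_state c), incumbent m = Some c
                & solution_cost m = (f h c)%:E]
}.

Lemma generate_from Q i0 s0 (m : memory P) c : Q c ->
  generated_from Q i0 s0 m -> generated_from Q i0 s0 (generate h m c).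
Proof.
move=> Qc [cm sm im]; rewrite /generate; case: ifP => gc; last first.
  by split=> //= c'; rewrite mem_rcons inE => /orP[/eqP->|/cm].
case: ifP => // fc; split=> //=; first exact: le_trans (ltW fc) sm.
by right; exists c.
Qed.

Lemma expand_from Q i0 s0 (m : memory P) x :
  (forall n c, x = Some n -> c \in children n -> Q c) ->
  generated_from Q i0 s0 m -> generated_from Q i0 s0 (Defs.expand h m x).
Proof.
case: x => //= n /(_ n _ erefl).
elim: (children n) m => //= c l IH m Ql Gm; apply: IH.
  by move=> c' c'l; apply: Ql; rewrite inE c'l orbT.
by apply: generate_from => //; apply: Ql; rewrite mem_head.
Qed.

Lemma pick_slot_from Q i0 s0 (m : memory P) : generated_from Q i0 s0 m ->
  (forall n, (pick_slot select m).1 = Some n -> Q n) /\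
  generated_from Q i0 s0 (pick_slot select m).2.
Proof.
case=> cm sm im; rewrite /pick_slot; case E: (candidates m) => [|c l].
  by split.
rewrite -E; have [|selm _] := @Hselect (candidates m); first by rewrite E.
split=> [n [<-]|]; first exact: cm.
by split=> //= c' /mem_rem/cm.
Qed.

Lemma fill_slots_from Q i0 s0 (m : memory P) b :
  (forall n c, Some n \in b -> c \in children n -> Q c) ->
  generated_from Q i0 s0 m ->
  (forall n, Some n \in (fill_slots h select m b).1 -> Q n) /\
  generated_from Q i0 s0 (fill_slots h select m b).2.
Proof.
elim: b m => //= x b IH m Qb Gm.
have /pick_slot_from : generated_from Q i0 s0 (Defs.expand h m x).
  by apply: expand_from => // n c xn; apply: Qb; rewrite xn mem_head.
case: pick_slot => s m' [/= Qs /IH].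
case: fill_slots => b' m'' [/= |Qb' Gm''].
  by move=> n c nb; apply: Qb; rewrite inE nb orbT.
by split=> // n; rewrite inE => /orP[/eqP/esym/Qs|/Qb'].
Qed.

(** * Runs, their invariants and ancestors in earlier beams *)

(** Iterates past the exit test, so that two widths can be compared at the same iteration even if
    one loop has already stopped. *)
Definition run (w i : nat) : config P := iter i (iteration h select) (initial P w).

Lemma loopE (c c' : config P) : loop h select c c' ->
  exists2 i, c' = iter i (iteration h select) c & ~~ continues h c'.
Proof.
elim=> {c c'} [c nc|c c' _ _ [i -> ni]]; first by exists 0%N.
by exists i.+1 => //; rewrite iterSr.
Qed.

(** The exit test may already fail before iteration [i]; the loop ends at the first such index
    [j]. *)
Lemma loop_run w i : ~~ continues h (run w i) ->
  exists j, loop h select (initial P w) (run w j).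
Proof.
rewrite /run; elim: i (initial P w) => [|i IH] c.
  by exists 0%N; apply: loop_exit.
have [cc|nc] := boolP (continues h c); last by exists 0%N; apply: loop_exit.
rewrite iterSr => /IH[j lj]; exists j.+1; rewrite iterSr; exact: loop_next.
Qed.

Lemma continuesP (c : config P) :
  reflect (exists2 n, Some n \in beam c & ((f h n)%:E < best_cost c)%E)
          (continues h c).
Proof.
apply: (iffP hasP) => [[[n|] // nb fn]|[n nb fn]]; first by exists n.
by exists (Some n).
Qed.

Lemma run_step w i :
  let Q c := exists2 n, Some n \in beam (run w i) & c \in children n in
  [/\ forall n, Some n \in beam (run w i.+1) -> Q n,
      (best_cost (run w i.+1) <= best_cost (run w i))%E
    & (best (run w i.+1) = best (run w i) /\
       best_cost (run w i.+1) = best_cost (run w i)) \/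
      exists c, [/\ Q c, goal (node_state c), best (run w i.+1) = Some c
                  & best_cost (run w i.+1) = (f h c)%:E]].
Proof.
move=> Q; rewrite /run iterS -/(run w i) /iteration.
set c := run w i in Q *; set m := Memory _ _ _.
have : generated_from Q (best c) (best_cost c) m by split=> //; left.
move=> /(@fill_slots_from _ _ _ _ (beam c)); case: fill_slots => b m' /=.
by case=> [n c' nb c'n|Qb [_ ? ?]]; [exists n | split].
Qed.

(** The exact depth is what turns a depth bound into termination. *)
Lemma run_beam_legal w i n : Some n \in beam (run w i) ->
  legal (start P) n /\ size n = i.
Proof.
elim: i n => [|i IH] n.
  by move=> /mapP[[|j] _ //] [->].
have [beamQ _ _] := run_step w i => /beamQ[n' /IH[ln' sn']].
by move=> /mapP[a an' ->] /=; rewrite ln' an' sn'.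
Qed.

Lemma run_best w i :
  if best (run w i) is Some n then
    is_solution n /\ best_cost (run w i) = (f h n)%:E
  else best_cost (run w i) = +oo%E.
Proof.
elim: i => [//|i IH].
have [_ _ [[-> ->] //|[c [[n nb cn] gc -> ->]]]] := run_step w i.
split=> //; split=> //; have [ln _] := run_beam_legal nb.
by move/mapP: cn => [a an ->] /=; rewrite ln.
Qed.

Lemma run_cost_anti w i j : (i <= j)%N ->
  (best_cost (run w j) <= best_cost (run w i))%E.
Proof.
elim: j => [|j IH]; first by rewrite leqn0 => /eqP->.
rewrite leq_eqVlt ltnS => /orP[/eqP->//|/IH]; apply: le_trans.
by have [] := run_step w j.
Qed.

Lemma run_ancestor w t i n : (t <= i)%N -> Some n \in beam (run w i) ->
  exists2 n', Some n' \in beam (run w t) & f h n' <= f h n.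
Proof.
elim: i n => [|i IH] n; first by rewrite leqn0 => /eqP->; exists n.
rewrite leq_eqVlt ltnS => /orP[/eqP->|ti]; first by exists n.
have [beamQ _ _] := run_step w i => /beamQ[n1 /(IH _ ti)[n' n't le1]].
move=> /mapP[a _ ->]; exists n' => //; exact: le_trans (f_parent a n1).
Qed.

(** Either the incumbent was already stored at iteration [t], or it was generated later from a beam
    node, whose ancestor at depth [t] was in the beam. *)
Lemma run_best_ancestor w t i n : (t <= i)%N -> best (run w i) = Some n ->
  (best_cost (run w t) <= (f h n)%:E)%E \/
  exists2 n', Some n' \in beam (run w t) & f h n' <= f h n.
Proof.
have now j : best (run w j) = Some n -> (best_cost (run w j) <= (f h n)%:E)%E.
  by move=> bj; have := run_best w j; rewrite bj => -[_ ->].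
elim: i => [|i IH]; first by rewrite leqn0 => /eqP-> /now; left.
rewrite leq_eqVlt ltnS => /orP[/eqP->/now|ti]; first by left.
have [_ _ [[-> _]|[c [[n1 n1i cn1] _ -> _ [<-]]]]] := run_step w i.
  exact: IH.
have [n' n't le1] := run_ancestor ti n1i.
right; exists n' => //; move/mapP: cn1 => [a _ ->].
exact: le_trans (f_parent a n1).
Qed.

(** * Widths [k] and [k.+1] compared *)

(** The extra slot is processed last, so it cannot affect the other slots of the next beam; it can
    only lower the cost. *)
Lemma run_widen k i : (0 < k)%N ->
  (exists x, beam (run k.+1 i) = rcons (beam (run k i)) x) /\
  (best_cost (run k.+1 i) <= best_cost (run k i))%E.
Proof.
move=> k0; elim: i => [|i [[x Ex] le21]].
  by split=> //=; rewrite mkseqS; eexists.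
rewrite /run !iterS -!/(run _ i) /iteration Ex -cats1.
set m2 := Memory _ (best (run k.+1 i)) _; set m1 := Memory _ (best (run k i)) _.
have /fill_slots_no_worse : no_worse m2 m1 by [].
move=> /(_ (beam (run k i))); have := fill_slots_cat m2 (beam (run k i)) [:: x].
case E2: (fill_slots h select m2) => [b2 m2'].
case: (fill_slots h select m1) => [b1 m1'].
rewrite [fill_slots _ _ m2' _]/=.
(* With a trivial [Q], only [cost_from] carries information: processing the extra slot does not
   raise the cost. *)
have Gm : generated_from (fun=> True) (incumbent m2') (solution_cost m2') m2'.
  by split=> //; left.
have := @pick_slot_from _ _ _ _
  (expand_from (x := x) (fun _ _ _ _ => I) Gm).
case: pick_slot => s m3 [_ [_ le3 _]] -> [/= -> [_ le']].
by split; [exists s; rewrite cats1 | apply: le_trans le'].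
Qed.

(** If [t] is past [T], costs are compared directly at [T]. Otherwise an ancestor of [sol] in the
    shared slots at [t] would keep the wider run going unless its cost were already low enough. *)
Lemma widen_stop_cost k T t sol : (0 < k)%N ->
  best (run k T) = Some sol -> ~~ continues h (run k.+1 t) ->
  (best_cost (run k.+1 t) <= (f h sol)%:E)%E.
Proof.
move=> k0 bT stop; have [tT|/ltnW Tt] := leqP t T; last first.
  apply: le_trans (run_cost_anti _ Tt) _.
  apply: le_trans (run_widen T k0).2 _.
  by have := run_best k T; rewrite bT => -[_ ->].
have [[x Ex] le21] := run_widen t k0.
have [|[n nt fn]] := run_best_ancestor tT bT; first exact: le_trans.
have : ~ ((f h n)%:E < best_cost (run k.+1 t))%E.
  move=> lt; move/negP: stop; apply; apply/continuesP; exists n => //.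
  by rewrite Ex mem_rcons inE nt orbT.
by move=> /negP; rewrite -leNgt => /le_trans; apply; rewrite lee_fin.
Qed.

(** The finite bound excludes an empty incumbent, whose cost is [+oo]. *)
Lemma run_stops_below w i sol :
  (forall s, 0 <= h s) -> admissible h -> is_solution sol ->
  (best_cost (run w i) <= (f h sol)%:E)%E ->
  exists sol', [/\ best (run w i) = Some sol', is_solution sol' & g sol' <= g sol].
Proof.
move=> h_ge0 h_adm solP; have := run_best w i.
case: (best _) => [sol' [sol'P ->]|->]; last by rewrite leNgt ltry.
by rewrite lee_fin !f_solution // => le'; exists sol'.
Qed.

End Run.

(** * Depth of nodes of bounded cost *)

Lemma g_monotone a n : legal (start P) (a :: n) -> g n <= g (a :: n).
Proof. by move=> /andP[_ an]; rewrite /g /= lerDl cost_ge0. Qed.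

Lemma bounded_cost_bounded_depth (C : R) :
  no_infinite_zero_cost_sequence P -> positive_costs_bounded_below P ->
  exists N, forall n, legal (start P) n -> g n < C -> (size n < N)%N.
Proof.
move=> Hzero [d d0 dP]; apply: contrapT => unbounded; apply: Hzero.
(* The search tree pruned to cost below [C]: since [g] grows along extensions, every legal node of
   cost below [C] remains reachable from the root. *)
pose kids n := [seq c <- children n | g c < C].
have reach n : legal (start P) n -> g n < C ->
    exists s, [/\ size s = size n, path (fun x y => y \in kids x) [::] s
                & last [::] s = n].
  elim: n => [|a n IH] lan gan; first by exists [::].
  have /andP[ln an] := lan.
  have [s [ss ps ls]] := IH ln (le_lt_trans (g_monotone lan) gan).
  exists (rcons s (a :: n)); rewrite size_rcons ss rcons_path ps ls last_rcons.
  by split=> //=; rewrite mem_filter gan map_f.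
have [N|u u0 uS] := @konig _ kids [::].
  apply: contrapT => nN; apply: unbounded; exists N => n ln gn.
  rewrite ltnNge; apply/negP => Nn; have [s [ss ps _]] := reach n ln gn.
  by apply: nN; exists (take N s); [rewrite size_takel ?ss | apply: take_path].
have {uS}/choice[a aP] : forall i, exists a,
    [/\ a \in actions (node_state (u i)), u i.+1 = a :: u i & g (u i.+1) < C].
  move=> i; have := uS i; rewrite mem_filter => /andP[gC /mapP[a an Ea]].
  by exists a; split.
have gS i : g (u i.+1) = g (u i) + cost (node_state (u i)) (a i).
  by have [_ -> _] := aP i.
have g_mono i j : (i <= j)%N -> g (u i) <= g (u j).
  elim: j => [|j IH]; first by rewrite leqn0 => /eqP->.
  rewrite leq_eqVlt ltnS => /orP[/eqP->//|/IH] /le_trans; apply.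
  by rewrite gS lerDl cost_ge0 //; have [] := aP j.
(* A zero-cost tail, shifted by [M], is a forbidden sequence. Otherwise costs of at least [d] recur
   forever and [g] is unbounded along the branch. *)
have [[M zeroM]|notail] := pselect (exists M, forall i, (M <= i)%N ->
    cost (node_state (u i)) (a i) = 0).
  exists (fun i => node_state (u (M + i)%N)), (fun i => a (M + i)%N) => i.
  have [ai Eu _] := aP (M + i)%N.
  by split; rewrite ?addnS ?Eu ?zeroM ?leq_addr.
have often M : exists2 i, (M <= i)%N & d <= cost (node_state (u i)) (a i).
  apply: contrapT => ni; apply: notail; exists M => i Mi.
  apply: contrapT => /eqP ci; apply: ni; exists i => //.
  by apply: dP => //; have [] := aP i.
have large m : exists i, m%:R * d <= g (u i).
  elim: m => [|m [i gi]]; first by exists 0%N; rewrite u0 mul0r.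
  have [j ij dj] := often i; exists j.+1.
  by rewrite gS -natr1 mulrDl mul1r lerD // (le_trans gi) ?g_mono.
(* By the Archimedean property this multiple of [d] exceeds [C], although [g] stays below [C] along
   the branch. *)
have [i] := large (Num.bound `|C / d|).
have [_ _ gC] := aP i.
have : C / d < (Num.bound `|C / d|)%:R.
  exact: le_lt_trans (ler_norm _) (archi_boundP (normr_ge0 _)).
rewrite ltr_pdivrMr // => Cd /(lt_le_trans Cd).
by rewrite ltNge (le_trans (g_mono _ _ (leqnSn i)) (ltW gC)).
Qed.

End Monobeam.

(** The second conjunct adds termination of the wider run. Infinitely many positive costs can have a
    finite sum, so it is stated under [positive_costs_bounded_below]. *)
Theorem theorem1 (R : realType) (P : search_problem R)
  (Hzero : no_infinite_zero_cost_sequence P)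
  (h : state P -> R) (h_ge0 : forall s : state P, 0 <= h s)
  (h_adm : admissible h)
  (select : seq (node P) -> node P) (Hselect : selects_minimum h select)
  (k : nat) (k_ge1 : (1 <= k)%N)
  (sol : node P) (Hsol : monobeam_returns h select k (Some sol)) :
  (forall r : option (node P),
     monobeam_returns h select k.+1 r ->
     exists sol' : node P,
       [/\ r = Some sol', is_solution sol' & g sol' <= g sol]) /\
  (positive_costs_bounded_below P ->
   exists sol' : node P,
     [/\ monobeam_returns h select k.+1 (Some sol'),
         is_solution sol' & g sol' <= g sol]).
Proof.
have [_ /loopE[T -> _] bT] := Hsol; rewrite -/(run h select k T) in bT.
have solP : is_solution sol.
  by have := run_best Hselect k T; rewrite bT => -[].
have stopP r : monobeam_returns h select k.+1 r ->
    exists sol', [/\ r = Some sol', is_solution sol' & g sol' <= g sol].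
  move=> [_ /loopE[t -> stop] <-]; rewrite -/(run h select k.+1 t) in stop *.
  apply: run_stops_below => //; exact: widen_stop_cost bT stop.
split=> // Hpos.
have [t stop] : exists t, ~~ continues h (run h select k.+1 t).
  have [N NP] := bounded_cost_bounded_depth (f h sol) Hzero Hpos.
  (* From [T] on, the wider run's cost is at most [f h sol]; from depth [N] on, every beam node has
     [g], hence [f], at least [f h sol]. *)
  exists (maxn T N); apply/continuesP => -[n /(run_beam_legal Hselect)[ln sn]].
  apply/negP; rewrite -leNgt.
  apply: le_trans (run_cost_anti Hselect _ (leq_maxl T N)) _.
  apply: le_trans (run_widen Hselect T k_ge1).2 _.
  have := run_best Hselect k T; rewrite bT => -[_ ->].
  rewrite lee_fin leNgt; apply/negP => fn.
  have gn : g n < f h sol.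
    by apply: le_lt_trans fn; apply: le_trans (f_ge_gh h n); rewrite lerDl h_ge0.
  by have := NP n ln gn; rewrite sn ltnNge leq_maxr.
have [j lj] := loop_run stop.
have ret : monobeam_returns h select k.+1 (best (run h select k.+1 j)).
  by exists (run h select k.+1 j).
have [sol' [Esol' sol'P gsol']] := stopP _ ret.
by rewrite Esol' in ret; exists sol'.
Qed.
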